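(* Let $\Delta\subset M_{\mathbb R}$, $\Delta^\circ\subset N_{\mathbb R}$ be dual reflexive polytopes with unimodular central triangulations $T$, $T^\circ$. If two toric divisors $D$ and $D'$ in $\mathrm{Div}_{\mathrm{toric}}\,\mathbb C\Sigma_T$ (with $\mathbb F_2$-coefficients) define the same class in $\mathrm{Pic}_{\mathbb F_2}(\mathbb C\Sigma_T)$, then the patchworked hypersurfaces $X_{T^\circ,T,D}$ and $X_{T^\circ,T,D'}$ coincide, up to an automorphism of $\mathbb R\Sigma_{T^\circ}$.
   Context: $M\cong\mathbb Z^{n+1}$ is a lattice, $N=\mathrm{Hom}(M,\mathbb Z)$, $M_{\mathbb R}=M\otimes\mathbb R$, $N_{\mathbb R}=N\otimes\mathbb R$. A full-dimensional lattice polytope $\Delta\subset M_{\mathbb R}$ is reflexive if it is defined by finitely many inequalities $\langle v,u\rangle\le1$ with $v\in N$; then $0$ is its unique interior lattice point and $\Delta^\circ=\{u\in N_{\mathbb R}:\langle u,v\rangle\le1\ \forall v\in\Delta\}$ is again reflexive. A central triangulation $T$ of $\Delta$ is a triangulation with vertices in $M$ consisting of the simplices of a triangulation of the boundary facets, of their convex hulls with $0$, and of $\{0\}$; it is unimodular if all maximal simplices have volume $1/(n+1)!$ (its vertices are then all of $\Delta\cap M$). $\Sigma_T$ (in $M_{\mathbb R}$) and $\Sigma_{T^\circ}$ (in $N_{\mathbb R}$) are the complete regular fans of cones over the simplices of $T$, $T^\circ$. $\mathbb C\Sigma$, $\mathbb R\Sigma$, $\mathbb R_+\Sigma$ denote the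 complex, real and nonnegative real toric varieties of a fan $\Sigma$. Divisors. The rays of $\Sigma_T$ are generated by the points $v\in\partial\Delta\cap M$, with toric divisors $D_v$. $\mathrm{Div}_{\mathrm{toric}}\,\mathbb C\Sigma_T=\bigoplus_v\mathbb F_2D_v$, and $\mathrm{Pic}_{\mathbb F_2}(\mathbb C\Sigma_T)$ is its quotient by the image of $N\otimes\mathbb F_2\to\mathrm{Div}_{\mathrm{toric}}\,\mathbb C\Sigma_T$, $n\mapsto\sum_v\langle n,v\rangle D_v$. A divisor $D=\sum_va_vD_v$ determines, up to inverting all signs, a sign distribution $\varepsilon:\Delta\cap M\to\mathbb F_2$ by: for $v\in\partial\Delta\cap M$, $\varepsilon(v)=\varepsilon(0)$ iff $a_v=1$. Patchworking. For a complete fan $\Sigma$ in $N_{\mathbb R}$, $\mathbb R\Sigma$ is the quotient of the disjoint union of copies $\mathbb R_+\Sigma(\xi)$, $\xi\in\mathrm{Hom}(M,\mathbb F_2)$, identifying $(p,\xi)\sim(p',\xi')$ iff $p=p'$ and $\xi,\xi'$ agree on $\rho^\perp\cap M$, where $\rho$ is the cone whose torus orbit contains $p$. For $\Sigma=\Sigma_\Delta$ the normal fan of $\Delta$, $\mathbb R_+\Sigma_\Delta$ is identified with $\Delta$ (moment map), so $\mathbb R\Sigma_\Delta$ is a quotient of copies $\Delta(\xi)$, triangulated by copies of $T$. Give the copy $v(\xi)$ of a lattice point $v$ in $\Delta(\xi)$ the sign $\xi(v)+\varepsilon(v)\in\mathbb F_2$. For each $\xi$ and each $(n+1)$-simplex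 $\sigma$ of $\Delta(\xi)$ take the union of the convex hulls of barycenters of the simplices in chains $\sigma_1\subset\cdots\subset\sigma$ of faces of $\sigma$ for which $\sigma_1$ is an edge whose endpoints have different signs. The union of all these is a PL hypersurface $X_{T,\varepsilon}\subset\mathbb R\Sigma_\Delta$. $X_{T^\circ,T,\varepsilon}$, also denoted $X_{T^\circ,T,D}$, is the compactification (closure) of $X_{T,\varepsilon}\cap(\mathbb R^* )^{n+1}$ in $\mathbb R\Sigma_{T^\circ}$, where $(\mathbb R^* )^{n+1}=N\otimes\mathbb R^*$ is the common open torus. It does not change when all signs are inverted. *)

(* Defs.v *)
From HB Require Import structures.
From mathcomp Require Import all_boot all_order all_algebra.
From mathcomp Require Import finmap.
From mathcomp Require Import all_classical all_reals all_analysis.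
Set Implicit Arguments.
Unset Strict Implicit.
Unset Printing Implicit Defensive.
Import Order.TTheory GRing.Theory Num.Theory.
Import numFieldNormedType.Exports.
Local Open Scope classical_set_scope.
Local Open Scope ring_scope.

(* In coordinates M = Z^d = 'rV[int]_d; K^d = 'rV[K]_d stands for both M (x) K
   and N (x) K = Hom(M, K), and [dotp] is the pairing between the two.
   In particular xi : 'rV['F_2]_d is the element m |-> dotp xi (lat 'F_2 m)
   of Hom(M, F_2). *)
Definition dotp (K : pzRingType) (d : nat) (u v : 'rV[K]_d) : K :=
  \sum_i u 0 i * v 0 i.

Definition lat (K : pzRingType) (d : nat) (m : 'rV[int]_d) : 'rV[K]_d :=
  map_mx intr m.

Section Convex.
Context {R : realType} {d : nat}.
Implicit Types (s : seq 'rV[R]_d) (u w : 'rV[R]_d).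

Definition hull s : set 'rV[R]_d :=
  [set u | exists a : 'rV[R]_d -> R,
     [/\ forall v, v \in s -> 0 <= a v,
         \sum_(v <- s) a v = 1
       & u = \sum_(v <- s) a v *: v]].

Definition cone s : set 'rV[R]_d :=
  [set u | exists a : 'rV[R]_d -> R,
     (forall v, v \in s -> 0 <= a v) /\ u = \sum_(v <- s) a v *: v].

(* For a full-dimensional polytope this is the union of its facets. *)
Definition boundary (A : set 'rV[R]_d) : set 'rV[R]_d := A `\` interior A.

Definition reflexive_polytope (Delta : set 'rV[R]_d) : Prop :=
  [/\ exists s : seq 'rV[int]_d, Delta = hull [seq lat R m | m <- s],
      interior Delta !=set0
    & exists s : seq 'rV[int]_d,
        Delta = [set u | forall v, v \in s -> dotp (lat R v) u <= 1]].

Definition polar (Delta : set 'rV[R]_d) : set 'rV[R]_d :=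
  [set u | forall v, Delta v -> dotp u v <= 1].

End Convex.

(* d-dimensional Lebesgue volume, by integrating over the first coordinate. *)
Fixpoint volume {R : realType} (d : nat) : set 'rV[R]_d -> \bar R :=
  match d return set 'rV[R]_d -> \bar R with
  | 0 => fun A => (`[< A 0 >]%:R)%:E
  | d'.+1 => fun A =>
      (\int[@lebesgue_measure R]_t
         volume [set x : 'rV[R]_d' | A (row_mx (t%:M : 'rV[R]_1) x)])%E
  end.

Section Triangulations.
Context {R : realType} {d : nat}.
Implicit Types (sigma tau : {fset 'rV[int]_d})
  (T B : {fset {fset 'rV[int]_d}}) (Delta : set 'rV[R]_d).

(* A lattice simplex is given by its set of vertices. *)
Definition simplex sigma : set 'rV[R]_d := hull [seq lat R v | v <- sigma].

Definition affinely_independent sigma : Prop :=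
  forall a : 'rV[int]_d -> R,
    \sum_(v <- sigma) a v = 0 -> \sum_(v <- sigma) a v *: lat R v = 0 ->
    forall v, v \in sigma -> a v = 0.

Definition triangulation T (A : set 'rV[R]_d) : Prop :=
  [/\ forall sigma, sigma \in T ->
        sigma != fset0 /\ affinely_independent sigma,
      forall sigma tau, sigma \in T -> (tau `<=` sigma)%fset ->
        tau != fset0 -> tau \in T,
      forall sigma tau, sigma \in T -> tau \in T ->
        simplex sigma `&` simplex tau = simplex (sigma `&` tau)%fset
    & \bigcup_(sigma in [set` T]) simplex sigma = A].

Definition central_triangulation T Delta : Prop :=
  triangulation T Delta /\
  exists2 B, triangulation B (boundary Delta) &
    forall sigma, sigma \in T <->
      [\/ sigma \in B,
          exists2 beta, beta \in B & sigma = (0 |` beta)%fset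
        | sigma = [fset 0]%fset].

Definition unimodular T : Prop :=
  forall sigma, sigma \in T ->
    (forall tau, tau \in T -> (sigma `<=` tau)%fset -> tau = sigma) ->
    volume (simplex sigma) = ((d`!)%:R^-1)%:E.

End Triangulations.
Arguments unimodular R {d} T.

Section Fans.
Context {R : realType} {d : nat}.

(* A fan is the set of its cones. *)
Definition fan_over (T : {fset {fset 'rV[int]_d}}) : set (set 'rV[R]_d) :=
  [set C | exists2 sigma, sigma \in T & C = cone [seq lat R v | v <- sigma]].

Definition max_face (Delta : set 'rV[R]_d) (w : 'rV[R]_d) : set 'rV[R]_d :=
  [set u | Delta u /\ forall u', Delta u' -> dotp w u' <= dotp w u].

Definition normal_cone (Delta F : set 'rV[R]_d) : set 'rV[R]_d :=
  [set w | F `<=` max_face Delta w].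

(* Outer normals: when Delta is reflexive, these are the cones over the faces
   of [polar Delta], so a fan over a central triangulation of [polar Delta]
   refines [normal_fan Delta]. *)
Definition normal_fan (Delta : set 'rV[R]_d) : set (set 'rV[R]_d) :=
  [set C | exists w, C = normal_cone Delta (max_face Delta w)].

Definition dual_cone (C : set 'rV[R]_d) : set 'rV[int]_d :=
  [set m | forall w, C w -> 0 <= dotp w (lat R m)].

Definition perp (C : set 'rV[R]_d) : set 'rV[int]_d :=
  [set m | forall w, C w -> dotp w (lat R m) = 0].

End Fans.

(* The real toric variety of a fan: the gluing of the affine charts
   U_sigma = Hom(sigma^dual /\ M, R), R being a multiplicative monoid.  A monoid morphism on
   sigma^dual /\ M is nonzero exactly on rho^perp for a unique face rho of
   sigma, and extends uniquely to rho^dual /\ M; the cone rho is that of the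
   torus orbit containing the point, and does not depend on the chart.  So a
   point is a cone rho of the fan together with a monoid morphism chi on
   rho^dual /\ M which is nonzero exactly on rho^perp /\ M; for uniqueness chi
   is extended by 0 to the whole of M.  For m in sigma^dual, [chi x m] is the
   value at x of the monomial of exponent m on U_sigma. *)
Record real_toric (R : realType) (d : nat) (Sigma : set (set 'rV[R]_d)) :=
  RealToric {
    orbit_cone : set 'rV[R]_d;
    chi : 'rV[int]_d -> R;
    orbit_coneP : Sigma orbit_cone;
    chi_neq0 : forall m, chi m <> 0 <-> perp orbit_cone m;
    chiD : forall m m', dual_cone orbit_cone m -> dual_cone orbit_cone m' ->
      chi (m + m') = chi m * chi m' }.

Section RealToric.
Context {R : realType} {d : nat}.
Implicit Types Sigma : set (set 'rV[R]_d).

(* In a fan, the faces of sigma are the cones of the fan contained in it. *)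
Definition chart Sigma (sigma : set 'rV[R]_d) : set (real_toric Sigma) :=
  [set x | orbit_cone x `<=` sigma].

HB.instance Definition _ Sigma := gen_eqMixin (real_toric Sigma).
HB.instance Definition _ Sigma := gen_choiceMixin (real_toric Sigma).

(* Euclidean topology: the charts are open, with the topology of pointwise
   convergence of the monomials. *)
Definition toric_subbase Sigma : set (set (real_toric Sigma)) :=
  [set W | exists sigma m (V : set R),
     [/\ Sigma sigma, dual_cone sigma m, open V
       & W = [set x | chart sigma x /\ V (chi x m)]]].

HB.instance Definition _ Sigma :=
  isSubBaseTopological.Build (real_toric Sigma) (@toric_subbase Sigma) id.

(* Regular functions: on the chart of sigma, quotients of elements of
   R[sigma^dual /\ M], represented by lists of terms (coefficient, exponent). *)
Definition laurent := seq (R * 'rV[int]_d).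

Definition laurent_on (sigma : set 'rV[R]_d) (p : laurent) : Prop :=
  forall t, t \in p -> dual_cone sigma t.2.

Definition laurent_eval Sigma (p : laurent) (x : real_toric Sigma) : R :=
  \sum_(t <- p) t.1 * chi x t.2.

Definition regular_at Sigma (g : real_toric Sigma -> R) (x : real_toric Sigma)
    : Prop :=
  exists sigma p q,
    [/\ Sigma sigma /\ chart sigma x, laurent_on sigma p, laurent_on sigma q,
        laurent_eval q x != 0
      & forall y, chart sigma y -> laurent_eval q y != 0 ->
          g y = laurent_eval p y / laurent_eval q y].

(* Regular maps: Zariski continuous, and regular in the coordinates of each
   chart of the target. *)
Definition regular_map Sigma (f : real_toric Sigma -> real_toric Sigma)
    : Prop :=
  forall x tau, Sigma tau -> chart tau (f x) ->
    (exists sigma q,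
       [/\ Sigma sigma /\ chart sigma x, laurent_on sigma q,
           laurent_eval q x != 0
         & forall y, chart sigma y -> laurent_eval q y != 0 ->
             chart tau (f y)]) /\
    (forall m, dual_cone tau m -> regular_at (fun y => chi (f y) m) x).

Definition toric_automorphism Sigma
    (f : real_toric Sigma -> real_toric Sigma) : Prop :=
  exists g : real_toric Sigma -> real_toric Sigma,
    [/\ cancel f g, cancel g f, regular_map f & regular_map g].

Definition nonneg_toric Sigma : set (real_toric Sigma) :=
  [set p | forall m, 0 <= chi p m].

Definition sign_char (xi : 'rV['F_2]_d) (m : 'rV[int]_d) : R :=
  (-1) ^+ (dotp xi (lat 'F_2 m) : nat).

Lemma sign_charD xi m m' :
  sign_char xi (m + m') = sign_char xi m * sign_char xi m'.
Proof.
rewrite /sign_char.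
have -> : dotp xi (lat 'F_2 (m + m')) =
    dotp xi (lat 'F_2 m) + dotp xi (lat 'F_2 m').
  rewrite /dotp -big_split; apply: eq_bigr => i _ /=.
  by rewrite !mxE intrD mulrDr.
by move: (dotp _ _) (dotp _ _) => [[|[|//]] ?] [[|[|//]] ?];
  rewrite /= ?expr0 ?expr1 ?mulr1 ?mul1r ?mulrNN ?mulr1.
Qed.

Lemma sign_char_neq0 xi m : sign_char xi m != 0.
Proof. by rewrite expf_neq0 // oppr_eq0 oner_eq0. Qed.

Lemma glue_neq0 Sigma xi (p : real_toric Sigma) m :
  sign_char xi m * chi p m <> 0 <-> perp (orbit_cone p) m.
Proof.
rewrite -chi_neq0; split=> [h e|/eqP h]; first by apply: h; rewrite e mulr0.
by apply/eqP; rewrite mulf_neq0 ?sign_char_neq0.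
Qed.

Lemma glueD Sigma xi (p : real_toric Sigma) m m' :
  dual_cone (orbit_cone p) m -> dual_cone (orbit_cone p) m' ->
  sign_char xi (m + m') * chi p (m + m') =
  (sign_char xi m * chi p m) * (sign_char xi m' * chi p m').
Proof. by move=> hm hm'; rewrite sign_charD chiD // mulrACA. Qed.

(* The image in the real toric variety of the point p of the copy, indexed by
   xi, of the nonnegative part: [glue] realizes the real toric variety as the
   quotient of these copies, see [glue_eq] and [glue_surj]. *)
Definition glue Sigma (xi : 'rV['F_2]_d) (p : real_toric Sigma) :
    real_toric Sigma :=
  @RealToric R d Sigma (orbit_cone p) (fun m => sign_char xi m * chi p m)
    (orbit_coneP p) (glue_neq0 xi p) (@glueD Sigma xi p).

Lemma real_toric_eq Sigma (x y : real_toric Sigma) :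
  orbit_cone x = orbit_cone y -> chi x = chi y -> x = y.
Proof.
case: x y => [C f H1 H2 H3] [C' f' H1' H2' H3'] /= eC ef.
by subst C' f'; congr RealToric; apply: Prop_irrelevance.
Qed.

Lemma glue_eq Sigma (p p' : real_toric Sigma) xi xi' :
  nonneg_toric p -> nonneg_toric p' ->
  glue xi p = glue xi' p' <->
  p = p' /\ forall m, perp (orbit_cone p) m ->
    dotp xi (lat 'F_2 m) = dotp xi' (lat 'F_2 m).
Proof.
have norm1 z m : `|sign_char z m| = 1 by rewrite /sign_char normrX normrN1 expr1n.
have inj (a b : 'F_2) : (-1) ^+ (a : nat) = (-1) ^+ (b : nat) :> R -> a = b.
  have N1 : (-1 : R) != 1 by rewrite lt_eqF // (lt_trans (ltrN10 R)).
  move: a b => [[|[|//]] ?] [[|[|//]] ?] /= /eqP;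
    rewrite ?expr0 ?expr1 ?(negbTE N1) 1?eq_sym ?(negbTE N1) // => _;
    exact: val_inj.
move=> p0 p0'; split=> [e|[<- e]]; last first.
  apply: real_toric_eq => //; apply/funext => m /=.
  have [/eqP h|] := boolP (chi p m == 0); first by rewrite h !mulr0.
  by move=> /eqP /chi_neq0 /e h; rewrite /sign_char h.
have eC : orbit_cone p = orbit_cone p' by case: e.
have ef m : sign_char xi m * chi p m = sign_char xi' m * chi p' m.
  by have /(congr1 (fun x => chi x m)) := e.
have ep : p = p'.
  apply: real_toric_eq => //; apply/funext => m.
  by move/(congr1 Num.norm): (ef m); rewrite !normrM !norm1 !mul1r !ger0_norm.
split=> // m /chi_neq0/eqP hm; apply: inj.
by move: (ef m); rewrite -ep => /(mulIf hm).
Qed.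

Lemma glue_surj Sigma (x : real_toric Sigma) :
  exists xi p, nonneg_toric p /\ x = glue xi p.
Proof.
pose P := perp (orbit_cone x); pose L : 'rV[int]_d -> 'rV['F_2]_d := @lat 'F_2 d.
have latD (K : pzRingType) (m m' : 'rV[int]_d) : lat K (m + m') = lat K m + lat K m' :> 'rV[K]_d.
  by apply/rowP => i; rewrite !mxE intrD.
have dotpDr (K : pzRingType) (u v w : 'rV[K]_d) :
    dotp u (v + w) = dotp u v + dotp u w.
  by rewrite /dotp -big_split; apply: eq_bigr => i _; rewrite mxE mulrDr.
have dotp0 (K : pzRingType) (u : 'rV[K]_d) : dotp u (0 : 'rV[K]_d) = 0.
  by rewrite /dotp big1 // => i _; rewrite mxE mulr0.
have lat0 (K : pzRingType) : lat K (0 : 'rV[int]_d) = 0.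
  by apply/rowP => i; rewrite !mxE.
have PD m m' : P m -> P m' -> P (m + m').
  by move=> h h' w hw; rewrite latD dotpDr h // h' // addr0.
have P0 : P 0 by move=> w _; rewrite lat0 dotp0.
have PN m : P m -> P (- m).
  move=> h w hw; have := dotp0 R w.
  by rewrite -(lat0 R) -(subrr m) latD dotpDr h // add0r.
have Pdual m : P m -> dual_cone (orbit_cone x) m.
  by move=> h w hw; rewrite h.
pose s m : 'F_2 := (chi x m < 0)%R%:R.
have sD m m' : P m -> P m' -> s (m + m') = s m + s m'.
  move=> h h'; rewrite /s chiD; [|exact: Pdual..].
  move: h h' => /chi_neq0/eqP + /chi_neq0/eqP.
  have e11 : (1 + 1 : 'F_2) = 0 by apply/val_inj.
  case: (ltrgt0P (chi x m)) => // hm _; case: (ltrgt0P (chi x m')) => // hm' _;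
    rewrite /= ?(pmulr_rlt0 _ hm) ?(nmulr_rlt0 _ hm) ?hm' ?(lt_gtF hm') /=
      ?addr0 ?add0r ?e11 //.
have s0 : s 0 = 0 by have := sD 0 0 P0 P0; rewrite addr0 => /esym/eqP;
  rewrite -subr_eq0 addrK => /eqP.
have addF2 (a : 'F_2) : a + a = 0.
  by move: a => [[|[|//]] ?]; apply/val_inj.
have s2 m : P m -> L m = 0 -> s m = 0.
  move=> hm /rowP h.
  have h2 i : (2 %| m ord0 i)%Z.
    by have /eqP := h i; rewrite !mxE -(dvdz_pcharf (pchar_Fp _)).
  pose m' : 'rV[int]_d := \row_i (m ord0 i %/ 2)%Z.
  have em : m = m' + m'.
    apply/rowP => i; rewrite !mxE -[LHS](divzK (h2 i)).
    by rewrite mulrDr !mulr1.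
  have hm' : P m'.
    move=> w /hm; rewrite em latD dotpDr -mulr2n => /eqP.
    by rewrite mulrn_eq0 /= => /eqP.
  by rewrite em sD // addF2.
pose c w : 'rV[int]_d := xget 0 [set m | P m /\ L m = w].
have Pc w : P (c w) by rewrite /c; case: xgetP => [m _ []|].
have sc m : P m -> s m = s (c (L m)).
  move=> hm; have [_ Lc] : P (c (L m)) /\ L (c (L m)) = L m.
    by rewrite /c; case: xgetP => [m' _ //|/(_ m)]; case.
  have hP : P (m - c (L m)) by apply: PD => //; apply: PN.
  rewrite -{1}(subrK (c (L m)) m) sD // (s2 _ hP) ?add0r //.
  have LL : L (m - c (L m)) + L (c (L m)) = L m by rewrite -latD subrK.
  by move: LL; rewrite Lc -[RHS]add0r => /addIr.
pose k := #|{: 'rV['F_2]_d}|.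
pose e (i : 'I_k) := c (enum_val i).
pose A : 'M['F_2]_(k, d) := \matrix_(i, j) L (e i) 0 j.
pose b : 'cV['F_2]_k := \col_i s (e i).
have /submxP [xi hxi] : (b^T <= A^T)%MS.
  rewrite submxE; apply/eqP/matrixP => i j; rewrite !mxE.
  set C := cokermx _.
  pose m := \sum_(l < k) if C l j == 0 then 0 else e l.
  have F2 (a : 'F_2) : a = (a != 0)%:R.
    by move: a => [[|[|//]] ?]; apply/val_inj.
  have Lm : L m = \sum_(l < k) C l j *: L (e l).
    rewrite /m (big_morph L (latD _) (lat0 _)); apply: eq_bigr => l _.
    rewrite {2}(F2 (C l j)); case: eqP => _ /=; first by rewrite scale0r; exact: lat0.
    by rewrite scale1r.
  have [Pm sm] : P m /\ s m = \sum_(l < k) C l j * s (e l).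
    rewrite /m; apply: (big_ind2 (fun u v => P u /\ s u = v)) => //.
      by move=> u1 v1 u2 v2 [p1 <-] [p2 <-]; split; [exact: PD|exact: sD].
    move=> l _; rewrite {3}(F2 (C l j)); case: eqP => _ /=.
      by rewrite mul0r.
    by rewrite mul1r; split => //; exact: Pc.
  rewrite -[RHS](s2 m Pm) ?sm.
    by apply: eq_bigr => l _; rewrite !mxE mulrC.
  rewrite Lm; apply/rowP => l.
  have /matrixP/(_ l j) := mulmx_coker A^T; rewrite !mxE => <-.
  by rewrite summxE; apply: eq_bigr => t _; rewrite !mxE mulrC.
have hs m : P m -> dotp xi (L m) = s m.
  move=> hm; have [_ Lc] : P (c (L m)) /\ L (c (L m)) = L m.
    by rewrite /c; case: xgetP => [m' _ //|/(_ m)]; case.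
  have /rowP/(_ (enum_rank (L m))) := hxi; rewrite !mxE /e enum_rankK.
  rewrite -sc // => ->; rewrite /dotp; apply: eq_bigr => i _.
  rewrite !mxE /e enum_rankK; congr (_ * _).
  by have /rowP/(_ i) := Lc; rewrite !mxE => <-.
exists xi, (glue xi x); split.
  move=> m /=; have [/eqP ->|/eqP/chi_neq0 hm] := boolP (chi x m == 0).
    by rewrite mulr0.
  rewrite /sign_char hs // /s; case: ltP => h /=; last by rewrite expr0 mul1r.
  by rewrite expr1 mulN1r oppr_ge0 ltW.
apply: real_toric_eq => //; apply/funext => m /=.
by rewrite mulrA -expr2 /sign_char sqrr_sign mul1r.
Qed.

(* Common points of the open tori Hom(M, R^* ) of two toric varieties. *)
Definition same_torus_point Sigma Sigma' (x : real_toric Sigma)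
    (y : real_toric Sigma') : Prop :=
  [/\ orbit_cone x = [set 0], orbit_cone y = [set 0] & chi x = chi y].

Definition lattice_points (Delta : set 'rV[R]_d) : set 'rV[int]_d :=
  [set m | Delta (lat R m)].

(* The moment map sum_m x^-m m / sum_m x^-m of the nonnegative part of the
   toric variety of [normal_fan Delta], with m in Delta /\ M; the sign is due
   to the use of outer normals.  Multiplying both sums by x^m0, for m0 in the
   face of Delta dual to the orbit cone of x, extends it to the boundary. *)
Definition moment Delta (p : real_toric (normal_fan Delta)) : 'rV[R]_d :=
  let m0 := xget 0 [set m | forall w, orbit_cone p w ->
                              max_face Delta w (lat R m)] in
  (\sum_(m \in lattice_points Delta) chi p (m0 - m))^-1 *:
  \sum_(m \in lattice_points Delta) chi p (m0 - m) *: lat R m.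

Definition barycenter (sigma : {fset 'rV[int]_d}) : 'rV[R]_d :=
  (#|` sigma|%:R)^-1 *: \sum_(v <- sigma) lat R v.

(* Chains sigma1 :: c from an edge sigma1, with endpoints of different
   signs, to a simplex sigma of dimension d. *)
Definition PL_piece (T : {fset {fset 'rV[int]_d}}) (s : 'rV[int]_d -> 'F_2) :
    set 'rV[R]_d :=
  [set u | exists sigma sigma1 (c : seq {fset 'rV[int]_d}),
     [/\ sigma \in T /\ #|` sigma| = d.+1,
         path fproper sigma1 c /\ last sigma1 c = sigma,
         exists v w, sigma1 = [fset v; w]%fset /\ s v != s w
       & hull [seq barycenter tau | tau <- sigma1 :: c] u]].

(* The hypersurface in the toric variety of the normal fan.  Only the values
   of eps on Delta /\ M matter. *)
Definition patchwork Delta T (eps : 'rV[int]_d -> 'F_2) :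
    set (real_toric (normal_fan Delta)) :=
  [set x | exists xi p, [/\ nonneg_toric p, x = glue xi p
     & PL_piece T (fun v => dotp xi (lat 'F_2 v) + eps v) (moment p)]].

(* Closure, in the toric variety of the fan over T', of the part of the
   hypersurface lying in the common open torus. *)
Definition patchwork_closure Delta (T' T : {fset {fset 'rV[int]_d}})
    (eps : 'rV[int]_d -> 'F_2) : set (real_toric (fan_over T')) :=
  closure [set y | exists2 x, @patchwork Delta T eps x & same_torus_point x y].

Definition boundary_point (Delta : set 'rV[R]_d) :=
  {v : 'rV[int]_d | boundary Delta (lat R v)}.

(* The toric divisor sum_v (D v) D_v of the toric variety of the fan over a
   unimodular central triangulation of Delta. *)
Definition toric_divisor (Delta : set 'rV[R]_d) := boundary_point Delta -> 'F_2.

Definition principal_divisor Delta (xi : 'rV['F_2]_d) : toric_divisor Delta :=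
  fun v => dotp xi (lat 'F_2 (sval v)).

Definition same_Pic_class Delta (D D' : toric_divisor Delta) : Prop :=
  exists xi, forall v, D v - D' v = principal_divisor xi v.

Definition sign_distribution Delta (D : toric_divisor Delta)
    (eps : 'rV[int]_d -> 'F_2) : Prop :=
  forall v, eps (sval v) = eps 0 <-> D v = 1.

End RealToric.
Arguments patchwork_closure {R d} Delta T' T eps.

(* Main.v *)
Require Import Defs.
From mathcomp Require Import all_boot all_order all_algebra.
From mathcomp Require Import finmap.
From mathcomp Require Import all_classical all_reals all_analysis.
Set Implicit Arguments.
Unset Strict Implicit.
Unset Printing Implicit Defensive.
Import Order.TTheory GRing.Theory Num.Theory.
Import numFieldNormedType.Exports.
Import Defs.
Local Open Scope classical_set_scope.
Local Open Scope ring_scope.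

(** Linear equivalence of D and D' is witnessed by some xi in Hom(M, F_2), and
    xi is at the same time an element of order two of the torus N (x) R^*: the
    point m |-> (-1)^xi(m).  Translation by this point multiplies the monomial
    of exponent m by (-1)^xi(m) on every toric variety of the torus; this is
    the map [glue xi], which is therefore an involutive regular automorphism
    ([glue_automorphism]) and a homeomorphism ([glue_continuous]).

    On the patchworking side, D - D' = div(xi) says that the sign distributions
    satisfy eps'(v) = eps(v) + xi(v) + constant at all vertices v of T
    ([sign_distribution_Pic]).  The constant is harmless, as only the inequality
    of signs at the two ends of an edge matters ([PL_piece_sign_shift]); the
    term xi(v) turns the signs of the copy Delta(zeta) for eps' into those of
    the copy Delta(zeta + xi) for eps.  Translation by xi permutes the copies
    in exactly this way and preserves the moment map, so it carries one
    hypersurface to the other in the toric variety of the normal fan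
    ([patchwork_glue]).  It does so inside the open torus, which that variety
    shares with the toric variety of the fan over T', and a homeomorphism
    commutes with closures. *)

Lemma F2_addrr (a : 'F_2) : a + a = 0.
Proof. exact: (addrr_pchar2 (pchar_Fp (isT : prime 2))). Qed.

Lemma sign_F2D (R : pzRingType) (a b : 'F_2) :
  (-1) ^+ ((a + b)%R : nat) = (-1) ^+ (a : nat) * (-1) ^+ (b : nat) :> R.
Proof.
by move: a b => [[|[|//]] ?] [[|[|//]] ?];
  rewrite /= ?expr0 ?expr1 ?mulr1 ?mul1r ?mulrNN ?mulr1.
Qed.

Lemma dotpDl (K : pzRingType) d (u v w : 'rV[K]_d) :
  dotp (u + v) w = dotp u w + dotp v w.
Proof.
by rewrite /dotp -big_split; apply: eq_bigr => i _; rewrite mxE mulrDl.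
Qed.

Lemma dotp0r (K : pzRingType) d (u : 'rV[K]_d) : dotp u (lat K 0) = 0.
Proof. by rewrite /dotp big1 // => i _; rewrite !mxE mulr0. Qed.

Lemma real_scalarl_open (R : realType) (a : R) (V : set R) :
  open V -> open [set t | V (a * t)].
Proof.
move=> oV; apply: (@open_comp _ _ ( *%R a)) => // t _.
exact: mulrl_continuous.
Qed.

Section ToricSignChange.
Context {R : realType} {d : nat} (Sigma : set (set 'rV[R]_d)).
Implicit Types (x y : real_toric Sigma) (xi : 'rV['F_2]_d).

(** The constant monomial is idempotent, and nonzero because 0 lies in the
    orthogonal of every cone. *)
Lemma chi0 x : chi x 0 = 1.
Proof.
have lat0 : lat R (0 : 'rV[int]_d) = 0 by apply/rowP => i; rewrite !mxE.
have /chi_neq0/eqP x0 : perp (orbit_cone x) 0 by move=> w _; rewrite dotp0r.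
apply: (mulfI x0); rewrite mulr1 -chiD ?addr0 // => w _;
  by rewrite dotp0r.
Qed.

Lemma glue_glue xi xi' x : glue xi (glue xi' x) = glue (xi + xi') x.
Proof.
apply: real_toric_eq => //; apply/funext => m /=.
by rewrite mulrA /sign_char dotpDl sign_F2D.
Qed.

(** Every element of Hom(M, F_2) is its own opposite. *)
Lemma glueK xi : involutive (@glue R d Sigma xi).
Proof.
move=> x; rewrite glue_glue; apply: real_toric_eq => //; apply/funext => m /=.
by rewrite /sign_char dotpDl F2_addrr mul1r.
Qed.

(** Orbit cones do not change, so every chart is mapped to itself; there, the
    pullback of a monomial is plus or minus this monomial, a quotient with
    denominator 1. *)
Lemma glue_regular xi : regular_map (@glue R d Sigma xi).
Proof.
have one y : laurent_eval [:: (1, 0)] y = 1.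
  by rewrite /laurent_eval big_seq1 chi0 mul1r.
move=> x tau Stau xtau.
have one_on : laurent_on tau [:: (1, 0)].
  by move=> t; rewrite inE => /eqP -> w _; rewrite dotp0r.
split=> [|m taum].
  by exists tau, [:: (1, 0)]; rewrite one oner_eq0.
exists tau, [:: (sign_char xi m, m)], [:: (1, 0)].
split=> //; first by move=> t; rewrite inE => /eqP ->.
  by rewrite one oner_eq0.
by move=> y _ _; rewrite one divr1 /laurent_eval big_seq1.
Qed.

Lemma glue_automorphism xi : toric_automorphism (@glue R d Sigma xi).
Proof.
by exists (glue xi); split; [exact: glueK|exact: glueK|exact: glue_regular..].
Qed.

Lemma toric_subbase_open (W : set (real_toric Sigma)) :
  toric_subbase W -> open W.
Proof.
move=> subW; exists [set W]; last by rewrite bigcup_set1.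
by move=> _ ->; exact: finI_from1.
Qed.

(** Continuity can be tested on the subbase, since taking preimages commutes
    with unions and with finite intersections. *)
Lemma toric_open_preimage (f : real_toric Sigma -> real_toric Sigma) :
  (forall W, toric_subbase W -> open (f @^-1` W)) ->
  forall U, open U -> open (f @^-1` U).
Proof.
move=> f_sub U [F FI <-]; rewrite preimage_bigcup; apply: bigcup_open => A /FI.
move=> [G subG <-]; rewrite preimage_bigcap.
rewrite bigcap_fset big_seq; apply: (big_ind open); [exact: openT|exact: openI|].
by move=> W /subG /set_mem; exact: f_sub.
Qed.

Lemma glue_continuous xi : continuous (@glue R d Sigma xi).
Proof.
apply/continuousP; apply: toric_open_preimage => _ [tau [m [V [Stau taum oV ->]]]].
apply: toric_subbase_open; exists tau, m, [set t | V (sign_char xi m * t)].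
by split => //; exact: real_scalarl_open.
Qed.

End ToricSignChange.

Lemma image_closure (X Y : topologicalType) (f : X -> Y) (A : set X) :
  continuous f -> f @` closure A `<=` closure (f @` A).
Proof.
move=> fc _ [x Ax <-] B /fc /Ax [y [Ay By]].
by exists (f y); split => //; exists y.
Qed.

(** Applying [image_closure] once more, to the image of A, gives the converse
    inclusion. *)
Lemma involution_image_closure (X : topologicalType) (f : X -> X) (A : set X) :
  involutive f -> continuous f -> f @` closure A = closure (f @` A).
Proof.
move=> fK fc; apply/seteqP; split; first exact: image_closure.
move=> y Ay; exists (f y); last exact: fK.
have := image_closure fc (ex_intro2 _ _ y Ay erefl).
by rewrite image_comp (_ : f \o f = id) ?image_id //; apply/funext.
Qed.

Section Patchworking.
Context {R : realType} {d : nat}.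
Implicit Types (T : {fset {fset 'rV[int]_d}}) (Delta : set 'rV[R]_d).

Definition vertices T : set 'rV[int]_d :=
  [set v | exists2 sigma, sigma \in T & v \in sigma].

(** The first simplex of a chain is an edge whose ends are vertices of T, and
    adding a constant to both signs keeps them different. *)
Lemma PL_piece_sign_shift T (s s' : 'rV[int]_d -> 'F_2) (c : 'F_2) :
  (forall v, vertices T v -> s' v = s v + c) ->
  PL_piece (R := R) T s `<=` PL_piece T s'.
Proof.
move=> ss' u [sigma [sigma1 [ch [[Tsigma card_sigma] [path_ch last_ch]]]]].
move=> [v [w [e vw]]] hull_u; exists sigma, sigma1, ch; split=> //.
exists v, w; split=> //.
have sub : (sigma1 `<=` sigma)%fset.
  rewrite -last_ch; elim: ch sigma1 path_ch {last_ch e hull_u} => //= t l IH r.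
  by move=> /andP[/fproper_sub rt /IH]; apply: fsubset_trans.
have vert z : z \in sigma1 -> vertices T z.
  by move=> z1; exists sigma => //; apply: (fsubsetP sub).
rewrite !ss' ?(inj_eq (addIr c)) //; apply: vert;
  by rewrite e !inE eqxx ?orbT.
Qed.

Lemma hull_vertex (s : seq 'rV[R]_d) u : u \in s -> hull s u.
Proof.
move=> su; have su0 : (count_mem u s)%:R != 0 :> R.
  by rewrite pnatr_eq0 -lt0n -has_count has_pred1.
(* s may list u several times, and hull then counts each occurrence *)
pose a v : R := (v == u)%:R / (count_mem u s)%:R.
have a1 : \sum_(v <- s) a v = 1.
  have -> : \sum_(v <- s) a v = (\sum_(v <- s | v == u) 1)%N%:R / (count_mem u s)%:R.
    by rewrite natr_sum [in RHS]big_mkcond mulr_suml; apply: eq_bigr => v _;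
      rewrite /a; case: eqP.
  by rewrite sum1_count divff.
exists a; split=> // [v _|]; first by rewrite divr_ge0 ?ler0n.
rewrite -[LHS]scale1r -a1 scaler_suml; apply: eq_bigr => v _.
by rewrite /a; case: eqP => [->//|_]; rewrite mul0r !scale0r.
Qed.

(** This makes the divisors, which only see the boundary lattice points,
    control the signs at all vertices of T. *)
Lemma central_vertex T Delta v :
  central_triangulation T Delta -> vertices T v ->
  v = 0 \/ boundary Delta (lat R v).
Proof.
move=> [_ [B [_ _ _ coverB] TB]] [sigma + v_sigma].
have onB beta : beta \in B -> v \in beta -> boundary Delta (lat R v).
  move=> Bbeta v_beta; rewrite -coverB; exists beta => //.
  exact/hull_vertex/map_f.
move=> /TB[/onB/(_ v_sigma)|[beta Bbeta e]|e]; first by right.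
  move: v_sigma; rewrite e => /fset1UP[|v_beta]; first by left.
  by right; exact: onB v_beta.
by left; move: v_sigma; rewrite e => /fset1P.
Qed.

(** Over F_2, the defining equivalence of a sign distribution is an affine
    equation. *)
Lemma sign_distributionE Delta (D : toric_divisor Delta) eps :
  sign_distribution D eps -> forall v, eps (sval v) = eps 0 + 1 + D v.
Proof.
move=> Deps v; have : (eps (sval v) == eps 0) = (D v == 1).
  by apply/eqP/eqP => /Deps.
move: (eps _) (eps 0) (D v) => [[|[|//]] ?] [[|[|//]] ?] [[|[|//]] ?] //= _;
  exact/val_inj.
Qed.

(** At a boundary vertex this is the difference of the affine equations for D
    and D'; at the origin xi vanishes, and the constant is chosen to make the
    identity hold there. *)
Lemma sign_distribution_Pic Delta T (D D' : toric_divisor Delta) xi eps eps' :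
  central_triangulation T Delta ->
  (forall v, D v - D' v = principal_divisor xi v) ->
  sign_distribution D eps -> sign_distribution D' eps' ->
  forall v, vertices T v ->
    eps' v = eps v + dotp xi (lat 'F_2 v) + (eps' 0 - eps 0).
Proof.
move=> Tc DD' Deps Deps' v /(central_vertex Tc)[->|bv].
  by rewrite dotp0r addr0 addrC subrK.
have := DD' (exist _ v bv); rewrite /principal_divisor /= => <-.
rewrite (sign_distributionE Deps (exist _ v bv)).
rewrite (sign_distributionE Deps' (exist _ v bv)) /=.
by move: (D _) (D' _) (eps 0) (eps' 0) => [[|[|//]] ?] [[|[|//]] ?] [[|[|//]] ?] [[|[|//]] ?];
  apply/val_inj.
Qed.

(** Translation by xi0 sends the copy of index xi to the copy of index
    xi0 + xi, with the same moment map.  There, the two occurrences of xi0(v),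
    one from the copy and one from eps', cancel. *)
Lemma patchwork_glue Delta T (eps eps' : 'rV[int]_d -> 'F_2) xi0 (c : 'F_2) :
  (forall v, vertices T v ->
     eps' v = eps v + dotp xi0 (lat 'F_2 v) + c) ->
  forall x, patchwork T eps x -> @patchwork _ _ Delta T eps' (glue xi0 x).
Proof.
move=> shift _ [xi [p [p0 -> piece_p]]].
exists (xi0 + xi), p; split=> //; first by rewrite glue_glue.
apply: (PL_piece_sign_shift (c := c)) piece_p => v /shift ->; rewrite dotpDl.
rewrite [X in X + _]addrC -!addrA; congr (_ + _).
by rewrite [eps v + _]addrCA [LHS]addrA F2_addrr add0r.
Qed.

(** The translations of the two toric varieties agree on their common torus. *)
Lemma patchwork_torus_glue Delta T (Sigma' : set (set 'rV[R]_d))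
    (eps eps' : 'rV[int]_d -> 'F_2) xi0 (c : 'F_2) :
  (forall v, vertices T v ->
     eps' v = eps v + dotp xi0 (lat 'F_2 v) + c) ->
  glue xi0 @` [set y : real_toric Sigma' |
     exists2 x, @patchwork _ _ Delta T eps x & same_torus_point x y] `<=`
  [set y | exists2 x, @patchwork _ _ Delta T eps' x & same_torus_point x y].
Proof.
move=> shift _ [y [x px [Cx Cy xy]] <-]; exists (glue xi0 x).
  exact: (patchwork_glue shift px).
by split => //=; rewrite xy.
Qed.

End Patchworking.

Theorem proposition4p1 (R : realType) (n : nat) (Delta : set 'rV[R]_n.+1)
    (T T' : {fset {fset 'rV[int]_n.+1}})
    (Delta_reflexive : reflexive_polytope Delta)
    (T_central : central_triangulation T Delta)
    (T_unimodular : unimodular R T)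
    (T'_central : central_triangulation T' (polar Delta))
    (T'_unimodular : unimodular R T')
    (D D' : toric_divisor Delta) (DD' : same_Pic_class D D')
    (eps eps' : 'rV[int]_n.+1 -> 'F_2)
    (D_eps : sign_distribution D eps) (D'_eps' : sign_distribution D' eps') :
  exists f : real_toric (fan_over T') -> real_toric (fan_over T'),
    toric_automorphism f /\
    f @` patchwork_closure Delta T' T eps = patchwork_closure Delta T' T eps'.
Proof.
case: DD' => xi DD'; exists (glue xi); split; first exact: glue_automorphism.
have shift := sign_distribution_Pic T_central DD' D_eps D'_eps'.
(* in characteristic two the relation between eps and eps' is symmetric *)
have shift' v : vertices T v ->
    eps v = eps' v + dotp xi (lat 'F_2 v) - (eps' 0 - eps 0).
  by move=> /shift ->; rewrite addrAC addrK -addrA F2_addrr addr0.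
rewrite /patchwork_closure involution_image_closure; first last.
- exact: glue_continuous.
- exact: glueK.
congr closure; apply/seteqP; split; first exact: patchwork_torus_glue shift.
move=> y Ay; exists (glue xi y); last exact: glueK.
by apply: (patchwork_torus_glue shift'); exists y.
Qed.
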